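(* Let $a>0$, $l\in\mathbb{R}$, $C_\ast>0$ and $q>1$. Assume that a uniformly continuous function $u:\mathbb{R}^3\to\mathbb{R}$ solves $$u(x)=l+C_\ast\int_{\mathbb{R}^3}\mathcal{K}_a(x-y)\,u^{q-1}(y)\big(1-u^q(y)\big)\,dy,\quad x\in\mathbb{R}^3.$$ If $$0\le u\le 1\ \text{ on }\mathbb{R}^3\qquad\text{and}\qquad\int_{\mathbb{R}^3}u^{q-1}(1-u^q)\,dx<\infty,$$ then one of the following two results holds: (i) $u\in L^{q-1}(\mathbb{R}^3)$ and $l=0$; (ii) $1-u^q\in L^1(\mathbb{R}^3)$ and $l=1$.
   Context: For $a>0$, $\mathcal{K}_a(x)=\frac{1-e^{-|x|/a}}{|x|}$ for $x\in\mathbb{R}^3\setminus\{0\}$. $u\in L^{q-1}(\mathbb{R}^3)$ means $\int_{\mathbb{R}^3}|u|^{q-1}\,dx<\infty$ (also when $q-1<1$). *)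

(* Defs.v *)
From HB Require Import structures.
From mathcomp Require Export all_boot all_order all_algebra.
From mathcomp Require Export all_classical all_reals all_analysis.
Export numFieldNormedType.Exports.

Set Implicit Arguments.
Unset Strict Implicit.
Unset Printing Implicit Defensive.
Import Order.TTheory GRing.Theory Num.Theory.
Local Open Scope classical_set_scope.
Local Open Scope ring_scope.

(* R^3 is the iterated product R * R * R: the library provides Lebesgue measure
   on R and product measures, but no measure on row vectors. *)
Definition lebesgue_measure3 (R : realType) :
    set (measurableTypeR R * measurableTypeR R * measurableTypeR R) -> \bar R :=
  (@lebesgue_measure R \x @lebesgue_measure R \x @lebesgue_measure R)%E.

HB.instance Definition _ (R : realType) := Measure.on (@lebesgue_measure3 R).

(* The library norm on a product is the sup norm; the kernel needs the
   Euclidean one. *)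
Definition enorm3 (R : realType) (x : R * R * R) : R :=
  Num.sqrt (x.1.1 ^+ 2 + x.1.2 ^+ 2 + x.2 ^+ 2).

(* At x = 0, where the kernel is undefined, the division convention gives 0. *)
Definition Kker (R : realType) (a : R) (x : R * R * R) : R :=
  (1 - expR (- (enorm3 x / a))) / enorm3 x.

(* Main.v *)
(* Write g = u^(q-1) (1 - u^q). The kernel is bounded by 1/a and by the inverse
   of the distance, so by dominated convergence the potential of the integrable
   function g vanishes at infinity, that is, u tends to l, and u >= l since the
   kernel is nonnegative. If 0 < l < 1, then g is bounded below by a positive
   constant outside a bounded set, contradicting its integrability. If l = 1,
   then u is identically 1; if l = 0, then u^(q-1) <= 2 g outside a cube. *)

From mathcomp Require Import lra measurable_realfun.
Require Import Defs.

Set Implicit Arguments.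
Unset Strict Implicit.
Unset Printing Implicit Defensive.
Import Order.TTheory GRing.Theory Num.Theory.
Local Open Scope classical_set_scope.
Local Open Scope ring_scope.

(** * Measurability of the solution and of the kernel *)

Lemma measurable_fun_comp_countable d d' (T : measurableType d)
    (U : measurableType d') (K : countType) (k : T -> K) (v : K -> U) :
  (forall i, measurable (k @^-1` [set i])) -> measurable_fun setT (v \o k).
Proof.
move=> mk _ Y mY; rewrite setTI.
(* The preimage is a union of fibres of [k], of which there are countably many. *)
suff -> : (v \o k) @^-1` Y =
    \bigcup_i (if v i \in Y then k @^-1` [set i] else set0).
  apply: countable_bigcupT_measurable => // i.
  by case: ifP.
apply/seteqP; split => [x Yx|x [i _]].
  by exists (k x) => //; rewrite mem_set.
by case: ifPn => // + /= kxi; rewrite kxi => /set_mem.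
Qed.

Lemma measurable_floor_preimage (R : realType) (c : R) (i : int) : 0 < c ->
  measurable [set t : R | Num.floor (t * c) = i].
Proof.
move=> c0.
suff -> : [set t : R | Num.floor (t * c) = i] =
    `[i%:~R / c, (i + 1)%:~R / c[%classic.
  exact: measurable_itv.
apply/seteqP; split => t /=;
  rewrite in_itv /= ler_pdivrMr// ltr_pdivlMr// -floor_eq.
  by move/eqP.
by move/eqP.
Qed.

(* Rounding the three coordinates down to the grid of mesh [1/(n+1)] makes the
   function countably valued; uniform continuity gives convergence. *)
Lemma unif_continuous_measurable_fun3 (R : realType) (u : R * R * R -> R) :
  unif_continuous u -> measurable_fun setT u.
Proof.
move=> uc.
pose k n (x : R * R * R) : int * int * int :=
  (Num.floor (x.1.1 * n.+1%:R), Num.floor (x.1.2 * n.+1%:R),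
   Num.floor (x.2 * n.+1%:R)).
pose r n (i : int * int * int) : R * R * R :=
  (i.1.1%:~R / n.+1%:R, i.1.2%:~R / n.+1%:R, i.2%:~R / n.+1%:R).
apply: (@measurable_fun_cvg _ _ _ _ (fun n => (u \o r n) \o k n)).
  move=> n; apply: measurable_fun_comp_countable => -[[i1 i2] i3].
  have -> : k n @^-1` [set (i1, i2, i3)] =
      [set t : R | Num.floor (t * n.+1%:R) = i1] `*`
      [set t : R | Num.floor (t * n.+1%:R) = i2] `*`
      [set t : R | Num.floor (t * n.+1%:R) = i3].
    by apply/seteqP; rewrite /k; split => -[[x1 x2] x3] /= =>
      [[-> -> ->]|[[-> ->] ->]].
  by repeat apply: measurableX; apply: measurable_floor_preimage.
have rk n (t : R) e : n.+1%:R^-1 < e ->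
    `|t - (Num.floor (t * n.+1%:R))%:~R / n.+1%:R| < e.
  apply: le_lt_trans; have /andP[lo hi] := floor_itv (t * n.+1%:R).
  have n0 : (0 : R) < n.+1%:R by [].
  rewrite ger0_norm ?subr_ge0 ?ler_pdivrMr// lerBlDl -[X in _ + X]div1r -mulrDl.
  by rewrite ler_pdivlMr// ltW// -[1]/(1%:~R) -rmorphD.
move=> x _; apply/cvgrPdist_lt => e e0.
have [d d0 ud] := (unif_continuousP _).1 uc e e0.
have := near_infty_natSinv_lt (PosNum d0); apply: filterS => n /= nd.
apply: (ud (x, r n (k n x))).
by split; [split|]; apply: rk.
Qed.

Lemma measurable_enorm3 (R : realType) : measurable_fun setT (@enorm3 R).
Proof.
have mg : measurable_fun setT
    (fun x : R * R * R => x.1.1 ^+ 2 + x.1.2 ^+ 2 + x.2 ^+ 2).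
  by repeat apply: measurable_funD; apply: measurable_funX => //;
    apply: measurableT_comp.
apply: measurableT_comp mg.
by apply: continuous_measurable_fun; exact: sqrt_continuous.
Qed.

Lemma measurable_Kker (R : realType) (a : R) : measurable_fun setT (Kker a).
Proof.
apply: measurable_funM.
  apply: measurable_funB => //; apply: measurableT_comp => //.
  apply: measurableT_comp => //; apply: measurable_funM => //.
  exact: measurable_enorm3.
(* Inversion as the power -1, which is measurable in its base; the two agree at 0 as well, where
   both are 0. *)
rewrite (_ : (fun _ => _) = (@powR R ^~ (-1)) \o @enorm3 R).
  by apply: measurableT_comp => //; exact: measurable_enorm3.
by apply/funext => x /=; rewrite powR_inv1// sqrtr_ge0.
Qed.

(** * Pointwise bounds on the kernel *)

Lemma norm_le_enorm3 (R : realType) (z : R * R * R) : `|z| <= enorm3 z.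
Proof.
have le_sqrt (s t : R) : t ^+ 2 <= s -> `|t| <= Num.sqrt s.
  by move=> ts; rewrite -sqrtr_sqr ler_wsqrtr.
have := (sqr_ge0 z.1.1, sqr_ge0 z.1.2, sqr_ge0 z.2) => -[[p1 p2] p3].
by rewrite !prod_normE !ge_max; apply/andP; split; [apply/andP; split|];
  apply: le_sqrt; lra.
Qed.

Lemma enorm3_ge0 (R : realType) (z : R * R * R) : 0 <= enorm3 z.
Proof. exact: sqrtr_ge0. Qed.

Lemma Kker_ge0 (R : realType) (a : R) z : 0 < a -> 0 <= Kker a z.
Proof.
move=> a0; rewrite mulr_ge0 ?invr_ge0 ?enorm3_ge0// subr_ge0 -expR0 ler_expR.
by rewrite oppr_le0 divr_ge0 ?enorm3_ge0 ?ltW.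
Qed.

(** With s = [enorm3 z / a] this is 1 - e^(-s) <= s, divided by the norm. The origin, where the
    kernel has its conventional value 0, is treated apart. *)
Lemma Kker_le_inv (R : realType) (a : R) z : 0 < a -> Kker a z <= a^-1.
Proof.
move=> a0; rewrite /Kker; have := enorm3_ge0 z.
rewrite le_eqVlt => /predU1P[<-|n0]; first by rewrite invr0 mulr0 invr_ge0 ltW.
rewrite ler_pdivrMr// lerBlDr -lerBlDl mulrC.
exact: expR_ge1Dx.
Qed.

(** The numerator is at most 1 and the Euclidean norm dominates the sup norm, so the decay can be
    measured in the sup norm. *)
Lemma Kker_le_norm_inv (R : realType) (a : R) (z : R * R * R) :
  0 < `|z| -> Kker a z <= `|z|^-1.
Proof.
move=> z0; have n0 := lt_le_trans z0 (norm_le_enorm3 z).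
apply: (@le_trans _ _ (enorm3 z)^-1); last by rewrite lef_pV2// norm_le_enorm3.
by rewrite ler_piMl ?invr_ge0 ?(ltW n0)// lerBlDr lerDl expR_ge0.
Qed.

Lemma measurable_Kker_shift (R : realType) (a : R) (x : R * R * R) :
  measurable_fun setT (fun y : R * R * R => Kker a (x - y)).
Proof.
apply: (measurableT_comp (measurable_Kker a)).
by apply/measurable_fun_pairP; split;
  [apply/measurable_fun_pairP; split|]; apply: measurable_funB => //;
  apply: measurableT_comp.
Qed.

(** * Decay of the potential at infinity *)

Section potential.
Context (R : realType) (a : R) (g : R * R * R -> R).
Hypotheses (a_gt0 : 0 < a) (g_ge0 : forall y, 0 <= g y)
  (mg : measurable_fun setT g)
  (g_int : (\int[@lebesgue_measure3 R]_y (g y)%:E < +oo)%E).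

Lemma Kker_mul_ge0 x y : 0 <= Kker a (x - y) * g y.
Proof. exact: mulr_ge0 (Kker_ge0 _ a_gt0) (g_ge0 y). Qed.

Lemma measurable_Kker_mul x :
  measurable_fun setT (fun y : R * R * R => (Kker a (x - y) * g y)%:E).
Proof.
apply/measurable_EFinP; apply: measurable_funM => //.
exact: measurable_Kker_shift.
Qed.

Lemma Kker_mul_cvg0 (x : nat -> R * R * R) y :
  (forall n, n%:R <= `|x n|) -> Kker a (x n - y) * g y @[n --> \oo] --> 0.
Proof.
move=> xn; apply/cvgr0Pnorm_le => e e0.
(* Past this threshold the distance from [x n] to [y] exceeds [g y / e]; the extra 1 makes this
   strict, hence the distance positive even if [g y = 0]. *)
have := @nbhs_infty_ger R (`|y| + g y / e + 1).
apply: filterS => n nM.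
have d0 : g y / e < `|x n - y|.
  have := lerB_dist (x n) y; have := xn n; move: nM => /=; lra.
have d00 : 0 < `|x n - y| by rewrite (le_lt_trans _ d0)// divr_ge0// ltW.
rewrite ger0_norm ?Kker_mul_ge0//.
apply: (@le_trans _ _ (`|x n - y|^-1 * g y)).
  by rewrite ler_wpM2r// Kker_le_norm_inv.
by rewrite mulrC ler_pdivrMr// mulrC -ler_pdivrMr// ltW.
Qed.

(** If every radius [n] failed, a choice of bad points would give a sequence going to infinity along
    which the potential stays above [e]. Dominated convergence, with majorant [a^-1 * g y], sends it
    to 0 instead. *)
Lemma potential_vanishes_at_infinity e : 0 < e ->
  exists M : R, forall x, M <= `|x| ->
  (\int[@lebesgue_measure3 R]_y (Kker a (x - y) * g y)%:E <= e%:E)%E.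
Proof.
move=> e0; apply: contrapT => noM.
have /choice[x xP] (n : nat) : exists x : R * R * R, n%:R <= `|x| /\
    (e%:E < \int[@lebesgue_measure3 R]_y (Kker a (x - y) * g y)%:E)%E.
  apply: contrapT => nox; apply: noM; exists n%:R => x nx.
  by rewrite leNgt; apply/negP => ex; apply: nox; exists x.
have := @dominated_cvg _ _ _ (@lebesgue_measure3 R) setT measurableT
  (fun n y => (Kker a (x n - y) * g y)%:E) (cst 0%E) (fun y => (a^-1 * g y)%:E).
have -> : (\int[@lebesgue_measure3 R]_y cst 0 y = 0)%E by rewrite integral0.
move=> /(_ (fun n => measurable_Kker_mul (x n))) cvg0.
suff : (e%:E <= 0)%E by rewrite lee_fin leNgt e0.
apply: (cvge_to_ge (cvg0 _ _ _ _)); last 1 first.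
- by apply: nearW => n; apply/ltW; case: (xP n).
- move=> y _; apply/fine_cvgP; split; first exact: nearW.
  by apply: Kker_mul_cvg0 => n; case: (xP n).
- by [].
- under eq_fun do rewrite EFinM.
  apply: integrableZl => //; apply/integrableP; split.
    exact/measurable_EFinP.
  by under eq_integral do rewrite gee0_abs ?lee_fin//.
- move=> n y _; rewrite gee0_abs lee_fin ?Kker_mul_ge0//.
  by rewrite ler_wpM2r// Kker_le_inv.
Qed.

End potential.

(** * Cubes of finite measure and half-spaces of infinite measure *)

Lemma lebesgue_measure3_prod (R : realType) (A B D : set R) :
  measurable A -> measurable B -> measurable D ->
  @lebesgue_measure3 R (A `*` B `*` D) =
  (lebesgue_measure A * lebesgue_measure B * lebesgue_measure D)%E.
Proof.
move=> mA mB mD; rewrite /lebesgue_measure3.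
rewrite product_measure1E//; last exact: measurableX.
by congr (_ * _)%E; exact: product_measure1E.
Qed.

Definition cube (R : realType) (M : R) : set (R * R * R) :=
  `[- M, M] `*` `[- M, M] `*` `[- M, M].

Lemma measurable_cube (R : realType) (M : R) : measurable (cube M).
Proof. by repeat apply: measurableX. Qed.

Lemma norm_ge_notin_cube (R : realType) (M : R) x : ~ cube M x -> M <= `|x|.
Proof.
apply: contra_notP => /negP; rewrite -ltNge !prod_normE !gt_max => xM.
case/andP: xM => /andP[x1M x2M] x3M.
by split; [split|] => /=; rewrite in_itv /= -ler_norml ltW.
Qed.

Lemma lebesgue_measure3_cube (R : realType) (M : R) :
  (@lebesgue_measure3 R (cube M) < +oo)%E.
Proof.
rewrite lebesgue_measure3_prod// !lebesgue_measure_itv /=.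
(* If [M <= 0] the interval, hence the cube, has measure 0. *)
by case: ifPn => _; rewrite ?mul0e// -EFinB -!EFinM ltry.
Qed.

(** This stands in for the complement of a cube: it also lies far from the origin, but it is a
    product, so its measure is computed factor by factor. *)
Definition halfspace (R : realType) (M : R) : set (R * R * R) :=
  `]M, +oo[ `*` setT `*` setT.

Lemma measurable_halfspace (R : realType) (M : R) : measurable (halfspace M).
Proof. by repeat apply: measurableX. Qed.

Lemma norm_ge_halfspace (R : realType) (M : R) x : halfspace M x -> M <= `|x|.
Proof.
move=> [[/= + _] _]; rewrite in_itv /= andbT => /ltW xM.
by rewrite !prod_normE !le_max (le_trans xM) ?ler_norm.
Qed.

Lemma lebesgue_measure3_halfspace (R : realType) (M : R) :
  @lebesgue_measure3 R (halfspace M) = +oo%E.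
Proof.
rewrite lebesgue_measure3_prod// -set_itvNyy !lebesgue_measure_itv /=.
by rewrite ltry addye// !mulyy.
Qed.

(** * The alternative for the limit value [l] *)

Theorem theorem1p6 (R : realType) (a l C q : R) (u : R * R * R -> R)
  (a_gt0 : 0 < a) (C_gt0 : 0 < C) (q_gt1 : 1 < q)
  (u_unif : unif_continuous u)
  (u_sol : forall x : R * R * R,
    ((u x)%:E = l%:E + C%:E *
      \int[@lebesgue_measure3 R]_y
        (Kker a (x - y) * u y `^ (q - 1) * (1 - u y `^ q))%:E)%E)
  (u01 : forall x : R * R * R, 0 <= u x <= 1)
  (u_int : (\int[@lebesgue_measure3 R]_x
              (u x `^ (q - 1) * (1 - u x `^ q))%:E < +oo)%E) :
  ((\int[@lebesgue_measure3 R]_x (`|u x| `^ (q - 1))%:E < +oo)%E /\ l = 0) \/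
  ((@lebesgue_measure3 R).-integrable [set: R * R * R]
      (fun x => (1 - u x `^ q)%:E) /\ l = 1).
Proof.
have mu := unif_continuous_measurable_fun3 u_unif.
have mup r : measurable_fun setT (fun x => u x `^ r).
  exact: (measurableT_comp (@measurable_powR R r) mu).
have u0 x : 0 <= u x by case/andP: (u01 x).
have u1 x : u x <= 1 by case/andP: (u01 x).
have q0 : 0 <= q by lra.
have q10 : 0 <= q - 1 by lra.
have one_pow (r : R) : 1 `^ r = 1 by rewrite powR1.
have le_pow (r s t : R) : 0 <= r -> 0 <= s -> s <= t -> s `^ r <= t `^ r.
  by move=> r0 s0 st; apply: ge0_ler_powR; rewrite // nnegrE// (le_trans s0).
pose g x := u x `^ (q - 1) * (1 - u x `^ q).
have uq1 x : u x `^ q <= 1 by rewrite -(one_pow q) le_pow.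
have g0 x : 0 <= g x by rewrite mulr_ge0 ?powR_ge0// subr_ge0.
have mg : measurable_fun setT g.
  by apply: measurable_funM => //; exact: measurable_funB.
have mgE : measurable_fun setT (fun x => (g x)%:E) by exact/measurable_EFinP.
pose P x := (\int[@lebesgue_measure3 R]_y (Kker a (x - y) * g y)%:E)%E.
have mupE : measurable_fun setT (fun x => (u x `^ (q - 1))%:E).
  exact/measurable_EFinP.
have mg2 : measurable_fun setT (fun x => (2%:E * (g x)%:E)%E).
  exact: emeasurable_funM.
have uE x : ((u x)%:E = l%:E + C%:E * P x)%E.
  rewrite u_sol; congr (_ + _ * _)%E.
  by apply: eq_integral => y _; rewrite mulrA.
have P0 x : (0 <= P x)%E.
  by apply: integral_ge0 => y _; rewrite lee_fin Kker_mul_ge0.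
have lu x : l <= u x.
  by rewrite -lee_fin uE leeDl// mule_ge0// lee_fin ltW.
have u_lim e : 0 < e -> exists M, forall x, M <= `|x| -> u x <= l + e.
  move=> e0; have eC : 0 < e / C by rewrite divr_gt0.
  have [M PM] := potential_vanishes_at_infinity a_gt0 g0 mg u_int eC.
  exists M => x /PM Px; rewrite -lee_fin uE EFinD leeD2l//.
  apply: (@le_trans _ _ (C%:E * (e / C)%:E)%E).
    by rewrite lee_pmul2l.
  by rewrite -EFinM lee_fin mulrC divfK// gt_eqF.
have l1 : l <= 1 by exact: le_trans (lu 0) (u1 0).
have l0 : 0 <= l.
  rewrite leNgt; apply/negP => l0.
  (* A negative [l] would force [u] below [l / 2 < 0] far away, for instance at [(M, 0, 0)]. *)
  have [M uM] : exists M, forall x, M <= `|x| -> u x <= l + (- l / 2).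
    by apply: u_lim; lra.
  have : M <= `|(M, 0, 0) : R * R * R|.
    by rewrite !prod_normE !le_max ler_norm.
  by move/uM; have := u0 (M, 0, 0); lra.
have [l_eq1|l_neq1] := eqVneq l 1.
  right; split => //.
  have -> : (fun x => (1 - u x `^ q)%:E) = cst 0%E.
    apply/funext => x; have -> : u x = 1 by apply/le_anti; rewrite u1 -l_eq1 lu.
    by rewrite one_pow subrr.
  exact: integrable0.
have {l_neq1} l_lt1 : l < 1 by rewrite lt_neqAle l_neq1.
left; have [l_eq0|l_neq0] := eqVneq l 0; last first.
  have l_gt0 : 0 < l by rewrite lt_neqAle eq_sym l_neq0.
  (* The midpoint of [l] and 1. Far away [l <= u x <= m], so the factors of [g x] are at least [l]^
     (q - 1)[and]1 - m [^ q]; their product is [c]. *)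
  exfalso; pose m := (1 + l) / 2.
  have [M uM] : exists M, forall x, M <= `|x| -> u x <= l + (1 - l) / 2.
    by apply: u_lim; lra.
  pose c := l `^ (q - 1) * (1 - m `^ q).
  have c0 : 0 < c.
    rewrite mulr_gt0 ?powR_gt0// subr_gt0 -(one_pow q).
    by apply: gt0_ltr_powR; rewrite ?nnegrE /m; lra.
  have mH := measurable_halfspace M.
  have cg x : halfspace M x -> c <= g x.
    move=> /norm_ge_halfspace xM; apply: ler_pM.
    - exact: powR_ge0.
    - by rewrite subr_ge0 -(one_pow q) le_pow /m//; lra.
    - exact: le_pow.
    - rewrite lerB// le_pow//.
      have -> : m = l + (1 - l) / 2 by rewrite /m; lra.
      exact: uM.
  have := u_int; rewrite ltNge => /negP; apply.
  (* The integral of [g] over the half-space is at least [c] times its infinite measure. *)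
  apply: (@le_trans _ _
      (\int[@lebesgue_measure3 R]_(x in halfspace M) (g x)%:E)%E).
    apply: (@le_trans _ _
        (\int[@lebesgue_measure3 R]_(x in halfspace M) (cst c%:E x))%E).
      rewrite integral_cst//.
      by rewrite [X in (_ * X)%E](lebesgue_measure3_halfspace M) gt0_muley.
    apply: ge0_le_integral; first exact: mH.
    - by move=> x _; rewrite lee_fin ltW.
    - exact: measurable_cst.
    - exact: measurable_funTS.
    - by move=> x /cg; rewrite lee_fin.
  have := @ge0_subset_integral _ _ _ (@lebesgue_measure3 R) (halfspace M) setT.
  by apply=> // x _; rewrite lee_fin; exact: g0.
split => //.
under eq_integral do rewrite ger0_norm//.
have [M uM] : exists M, forall x, M <= `|x| -> u x <= l + 2^-1.
  by apply: u_lim; lra.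
have mB := measurable_cube M.
have mI : measurable_fun setT (fun x => (\1_(cube M) x)%:E : \bar R).
  by apply/measurable_EFinP.
apply: (@le_lt_trans _ _
    (\int[@lebesgue_measure3 R]_x (2%:E * (g x)%:E + (\1_(cube M) x)%:E))%E).
  apply: ge0_le_integral => //.
  - by move=> x _; rewrite lee_fin powR_ge0.
  - exact: (emeasurable_funD mg2 mI).
  - move=> x _; rewrite -EFinM -EFinD lee_fin indicE.
    have [/set_mem xB|/negP xB] := boolP (x \in cube M).
      have : u x `^ (q - 1) <= 1 by rewrite -[leRHS](one_pow (q - 1)) le_pow.
      have := g0 x; rewrite /=; lra.
    have ux : u x <= 2^-1.
      by rewrite -[2^-1]add0r -l_eq0; apply/uM/norm_ge_notin_cube => /mem_set.
    have : u x `^ q <= 2^-1.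
      apply: le_trans (le_pow q _ _ q0 (u0 x) ux) _.
      by apply: ge1r_powR; lra.
    have := powR_ge0 (u x) (q - 1); rewrite /g /=; nra.
rewrite ge0_integralD//; last by move=> x _; rewrite -EFinM lee_fin mulr_ge0.
rewrite ge0_integralZl//; last by move=> x _; rewrite lee_fin.
rewrite integral_indic// setIT lte_add_pinfty ?lebesgue_measure3_cube//.
by rewrite lte_mul_pinfty// lee_fin.
Qed.
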